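(* Let $\gamma$ be a non-zero algebraic number with $\deg\gamma\le 2$. (i) If $\mathbb Q(\gamma)\neq\mathbb Q(i)$ and $\mathbb Q(\gamma)\ne\mathbb Q(i\sqrt3)$, then $\bar M(\gamma)=M(\gamma)$. (ii) If $\gamma=a+bi$ with $a,b\in\mathbb Q$, then $\bar M(\gamma)=M(b)$ if $a=0$, and $\bar M(\gamma)=M(\gamma)$ if $a\neq0$. (iii) If $\gamma=a+b\sqrt{-3}$ with $a,b\in\mathbb Q$, then $\bar M(\gamma)=M(2a)$ if $a\in\{b,-b\}$, and $\bar M(\gamma)=M(\gamma)$ if $a\notin\{b,-b\}$.
   Context: For a non-zero algebraic number $\gamma$ with minimal polynomial $A\prod_{n=1}^N(x-\gamma_n)$ over $\mathbb Z$ (primitive, $A>0$), $M(\gamma)=A\prod_{n=1}^N\max\{1,|\gamma_n|\}$. The modified Mahler measure is $\bar M(\gamma)=\inf\{M(\zeta\gamma):\zeta\text{ a root of unity}\}$. *)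

(* Defs.v *)
From HB Require Import structures.
From mathcomp Require Import all_boot all_order all_algebra all_field.
From Stdlib Require Import ClassicalEpsilon.
Set Implicit Arguments. Unset Strict Implicit. Unset Printing Implicit Defensive.
Import Order.TTheory GRing.Theory Num.Theory.
Local Open Scope ring_scope.

Definition algdeg (x : algC) : nat := (size (minCpoly x)).-1.

(* p is the minimal polynomial of x over Z: primitive (content 1, hence
   positive leading coefficient A > 0) and a scalar multiple of the
   minimal polynomial of x over Q. *)
Definition int_minpoly (x : algC) (p : {poly int}) : Prop :=
  zcontents p = 1 /\ 0 < lead_coef p /\
  map_poly (fun c : int => c%:~R) p = (lead_coef p)%:~R *: minCpoly x.

Definition is_mahler (x m : algC) : Prop :=
  exists (p : {poly int}) (s : seq algC),
    int_minpoly x p /\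
    minCpoly x = \prod_(z <- s) ('X - z%:P) /\
    m = (lead_coef p)%:~R * \prod_(z <- s) Num.max 1 `|z|.

Definition mahler (x : algC) : algC :=
  epsilon (inhabits 0) (is_mahler x).

Definition root_of_unity (z : algC) : Prop :=
  exists2 n : nat, (0 < n)%N & z ^+ n = 1.

Definition is_mbar (x m : algC) : Prop :=
  (forall z, root_of_unity z -> m <= mahler (z * x)) /\
  (forall y, y \is Num.real ->
     (forall z, root_of_unity z -> y <= mahler (z * x)) -> y <= m).

Definition mbar (x : algC) : algC :=
  epsilon (inhabits 0) (is_mbar x).

Definition in_Qgen (x y : algC) : Prop :=
  exists p q : {poly algC},
    [/\ p \is a polyOver Crat, q \is a polyOver Crat, q.[x] != 0
      & y = p.[x] / q.[x]].

Definition same_Qfield (x y : algC) : Prop :=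
  forall w, in_Qgen x w <-> in_Qgen y w.

(* Main.v *)
Require Import Defs.
From HB Require Import structures.
From mathcomp Require Import all_boot all_order all_algebra all_fingroup all_field.
From mathcomp Require Import ring zify.
From Stdlib Require Import ClassicalEpsilon.
Set Implicit Arguments. Unset Strict Implicit. Unset Printing Implicit Defensive.
Import Order.TTheory GRing.Theory Num.Theory.
Local Open Scope ring_scope.

(* M(x)^(1/deg x) does not change when x is multiplied by a root of unity z: up to
   multiplicities, the conjugates of x and of z x agree up to roots of unity, and
   the leading coefficient of a primitive polynomial c prod (X - x_i) is determined
   by which numbers b prod_(i in S) x_i are algebraic integers, a condition blind to
   roots of unity. Hence the infimum defining mbar is reached at the multiple z x
   of least degree. For deg x = 2 a smaller degree forces x = r v with r rational
   and v a root of unity of degree 2; then v + v^-1 is an integer of absolute value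
   less than 2, which leaves the orders 3, 4 and 6. *)

Local Notation pZtoC := (map_poly (intr : int -> algC)).

(** * Conjugates and algebraic integers *)

Lemma minCpoly_prod_XsubC (x : algC) :
  {s : seq algC | minCpoly x = \prod_(z <- s) ('X - z%:P)}.
Proof.
have [s Ds] := closed_field_poly_normal (minCpoly x); exists s.
by rewrite {1}Ds (monicP (minCpoly_monic x)) scale1r.
Qed.

(** The roots of [minCpoly x] generate a number field normal over the rationals. Its Galois group
    moves [x] to any other root, and the automorphism found there extends to [algC]. *)
Lemma minCpoly_transitive (x y : algC) :
  root (minCpoly x) y -> exists nu : {rmorphism algC -> algC}, nu x = y.
Proof.
have [s Ds] := minCpoly_prod_XsubC x => pxy.
have s_x: x \in s by rewrite -root_prod_XsubC -Ds root_minCpoly.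
have s_y: y \in s by rewrite -root_prod_XsubC -Ds.
have [Qs [QsC [s1 Ds1 genQs]]] := num_field_exists s.
have [q [Dq mon_q] q_min] := minCpolyP x.
have ratQs (a : rat) : QsC a%:A = ratr a by rewrite alg_num_field fmorph_rat.
pose q1 := map_poly (in_alg Qs) q.
have q1C: map_poly QsC q1 = minCpoly x.
  by rewrite Dq -map_poly_comp; apply: eq_map_poly => a /=; rewrite ratQs.
have Dq1: q1 = \prod_(z <- s1) ('X - z%:P).
  apply: (map_poly_inj QsC); rewrite q1C Ds -Ds1 big_map rmorph_prod.
  by apply: eq_bigr => z _; rewrite rmorphB /= map_polyX map_polyC.
have q1_over: q1 \is a polyOver 1%VS.
  by apply/polyOverP => i; rewrite coef_map /= memvZ ?mem1v.
have split_ax: FieldExt_isSplittingField _ Qs.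
  by constructor; exists q1 => //; exists s1; rewrite // Dq1 eqpxx.
pose L : splittingFieldType rat := HB.pack Qs split_ax.
have /mapP[x1 s1x Dx] : x \in map QsC s1 by rewrite Ds1.
have /mapP[y1 s1y Dy] : y \in map QsC s1 by rewrite Ds1.
(* The minimal polynomial of [x1] over the base field has rational coefficients and vanishes at
   [x1], so [q] divides it; and [y] is a root of [q]. *)
have min_y1: root (minPoly (L := L) 1 x1) y1.
  have [p Dp]: exists p : {poly rat}, minPoly (L := L) 1 x1 = map_poly (in_alg L) p.
    have aP i: (minPoly (L := L) 1 x1)`_i \in 1%VS.
      exact/polyOverP/minPolyOver.
    have a_ i := sig_eqW (vlineP _ _ (aP i)).
    exists (\poly_(i < size (minPoly (L := L) 1 x1)) sval (a_ i)).
    apply/polyP=> i; rewrite coef_map coef_poly; case: ltnP => [_ | le_sz_i].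
      by case: (a_ i).
    by rewrite nth_default //= scale0r.
  have := root_minPoly (L := L) 1 x1; rewrite Dp.
  rewrite -!(fmorph_root QsC) -map_poly_comp -Dx -Dy.
  rewrite (eq_map_poly (g := ratr)) => [|a /=]; last exact: ratQs.
  rewrite q_min => /dvdpP[r ->].
  by rewrite rmorphM rootM /= -Dq pxy orbT.
have normL: normalField (L := L) 1 fullv.
  apply/splitting_normalField; first exact: sub1v.
  by exists q1 => //; exists s1; rewrite // Dq1 eqpxx.
have [u _ Du] := normalField_root_minPoly (L := L) (sub1v _) normL (memvf x1) min_y1.
have uM: monoid_morphism (u : L -> L).
  by split=> [|a b]; [rewrite rmorph1 | rewrite rmorphM].
pose phiM := GRing.isMonoidMorphism.Build _ _ (fun_of_lfun (gal_repr u)) uM.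
pose phi : {rmorphism L -> L} := HB.pack (fun_of_lfun (gal_repr u)) phiM.
have [nu Dnu] := extend_algC_subfield_aut QsC phi.
by exists nu; rewrite Dx -Dnu /= Du -Dy.
Qed.

(** Translates integrality into the form covered by the general theory of integral elements;
    [minCpoly x] itself is the monic witness. *)
Lemma Aint_integralOver (x : algC) :
  (x \in Aint) <-> integralOver (intr : int -> algC) x.
Proof.
split=> [Ax | [p mon_p px0]].
  move: (Ax); rewrite unfold_in => /floorpP[p Dp]; exists p; last first.
    by rewrite -Dp root_minCpoly.
  apply/monicP/(intr_inj (R := algC)); rewrite -lead_coef_map_inj //.
    by rewrite -Dp (monicP (minCpoly_monic x)).
  exact: intr_inj.
apply: (root_monic_Aint px0); first by rewrite monic_map.
by apply/polyOverP => i; rewrite coef_map /= intr_int.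
Qed.

Lemma root_monic_polyOver_Aint (p : {poly algC}) (x : algC) :
  p \is monic -> p \is a polyOver Aint -> root p x -> x \in Aint.
Proof.
move=> mon_p /polyOverP Ap px; apply/Aint_integralOver.
apply: (integral_root_monic mon_p px).
by apply/integral_poly => i; apply/Aint_integralOver.
Qed.

(* With [c] the leading coefficient and [d] the degree of [p], the number [c * x]
   is a root of the monic polynomial [c ^ (d - 1) p (X / c)]. *)
Lemma lead_coef_mul_root_Aint (p : {poly algC}) (x : algC) :
  p \is a polyOver Aint -> root p x -> lead_coef p * x \in Aint.
Proof.
move=> /polyOverP Ap px0; have [->|nz_p] := eqVneq p 0.
  by rewrite lead_coef0 mul0r rpred0.
have := root_size_gt1 nz_p px0; set c := lead_coef p.
(* The size is [d.+2], hence the degree [d.+1], and [c ^+ d] is the factor that makes the equation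
   for [c * x] monic. *)
case Dn: (size p) => [|[|d]] // _.
have Dc: c = p`_d.+1 by rewrite /c lead_coefE Dn.
pose r := \poly_(i < d.+1) (p`_i * c ^+ (d - i)).
have lt_r: (size r < size ('X^(d.+1) : {poly algC})%R)%N.
  by rewrite size_polyXn ltnS size_poly.
apply: (@root_monic_polyOver_Aint ('X^(d.+1) + r) (c * x)).
- by rewrite monicE lead_coefDl // lead_coefXn.
- rewrite rpredD ?rpredX ?polyOverX //; apply/polyOverP => i.
  by rewrite coef_poly; case: ifP => _; rewrite ?rpred0 // rpredM ?rpredX ?Ap.
rewrite /root; suff -> : ('X^(d.+1) + r).[c * x] = c ^+ d * p.[x].
  by rewrite (rootP px0) mulr0.
rewrite hornerD hornerXn horner_poly horner_coef Dn [in RHS]big_ord_recr /= -Dc.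
rewrite mulrDr mulr_sumr addrC; congr (_ + _).
  apply: eq_bigr => i _; have le_i_d: (i <= d)%N by rewrite -ltnS ltn_ord.
  have -> : c ^+ d = c ^+ (d - i) * c ^+ i by rewrite -exprD subnK.
  rewrite exprMn.
  by rewrite [p`_i * _]mulrC mulrACA.
by rewrite exprMn exprSr mulrA.
Qed.

(** Induction on the size. The leading coefficient [c] of [p] is an algebraic integer, and so is
    [c * x] because [x] is a root of the product; removing the leading term of [p] therefore keeps
    the product integral. *)
Lemma polyOver_Aint_mulXsubC (p : {poly algC}) (x : algC) :
  p * ('X - x%:P) \is a polyOver Aint -> p \is a polyOver Aint.
Proof.
have [n] := ubnP (size p); elim: n p => // n IHn p /ltnSE le_p_n Apx.
have [->|nz_p] := eqVneq p 0; first exact: rpred0.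
have lead_px: lead_coef (p * ('X - x%:P)) = lead_coef p.
  by rewrite lead_coefM lead_coefXsubC mulr1.
have Ac: lead_coef p \in Aint by rewrite -lead_px lead_coefE; move/polyOverP: Apx; apply.
have Acx: lead_coef p * x \in Aint.
  rewrite -lead_px; apply: lead_coef_mul_root_Aint => //.
  by rewrite rootM root_XsubC eqxx orbT.
pose h := lead_coef p *: 'X^((size p).-1).
have Ah : h \is a polyOver Aint by rewrite polyOverZ ?rpredX ?polyOverX.
rewrite -(subrK h p) rpredD //; apply: IHn.
  apply: leq_trans le_p_n; rewrite (polySpred nz_p) ltnS.
  apply/leq_sizeP => j le_p_j; rewrite coefB coefZ coefXn.
  have [->|ne_j] := eqVneq j; first by rewrite mulr1 subrr.
  rewrite mulr0 subr0 nth_default // (polySpred nz_p) ltn_neqAle le_p_j.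
  by rewrite eq_sym ne_j.
rewrite mulrBl rpredB // mulrBr rpredB //; first by rewrite rpredM ?polyOverX.
rewrite /h mulrC mul_polyC scalerA mulrC polyOverZ ?rpredX ?polyOverX //.
Qed.

(** An entry of [r] pairs a multiplier with a root. Dropping a factor ['X - x%:P] leaves an integral
    product, both with constant [c] and with constant [c * x]. The twisted product recombines these
    two, with [v] joining the constant of the second; this is why [u] is carried through the
    induction. *)
Lemma polyOver_Aint_prod_XsubC_twist (c u : algC) (r : seq (algC * algC)) :
    u \in Aint -> {in unzip1 r, forall v, v \in Aint} ->
  c *: \prod_(z <- r) ('X - z.2%:P) \is a polyOver Aint ->
  (u * c) *: \prod_(z <- r) ('X - (z.1 * z.2)%:P) \is a polyOver Aint.
Proof.
elim: r c u => [|[v x] r IHr] c u Au /= Av.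
  rewrite !big_nil -!mul_polyC !mulr1 polyCM => Ac.
  by apply: rpredM; rewrite // polyOverC.
have{Av} [Av Ar]: v \in Aint /\ {in unzip1 r, forall w, w \in Aint}.
  by split=> [|w r_w]; apply: Av; rewrite inE ?eqxx ?r_w ?orbT.
rewrite !big_cons /= mulrC scalerAl => Acx.
have Ac := polyOver_Aint_mulXsubC Acx.
have Acx': (c * x) *: \prod_(z <- r) ('X - (z.2)%:P) \is a polyOver Aint.
  suff -> : (c * x) *: \prod_(z <- r) ('X - (z.2)%:P) =
      c *: \prod_(z <- r) ('X - (z.2)%:P) * 'X -
      c *: \prod_(z <- r) ('X - (z.2)%:P) * ('X - x%:P).
    by apply: rpredB => //; apply: rpredM (polyOverX _).
  by rewrite -mulrBr subKr [RHS]mulrC mul_polyC scalerA mulrC.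
rewrite mulrBl scalerBr rpredB //.
  by rewrite -mul_polyC mulrCA mul_polyC rpredM ?polyOverX ?IHr.
rewrite mul_polyC scalerA.
have -> : u * c * (v * x) = (u * v) * (c * x) by rewrite mulrACA.
by rewrite IHr ?rpredM.
Qed.

(** * Invariance of the Mahler measure up to the degree *)

Lemma prod_flatten_nseq (R : comNzRingType) (T : Type) (k : nat) (s : seq T)
    (F : T -> R) :
  \prod_(x <- flatten (nseq k s)) F x = (\prod_(x <- s) F x) ^+ k.
Proof. by elim: k => [|k IHk] /=; rewrite ?big_nil // big_cat exprS /= IHk. Qed.

Lemma map_flatten_nseq (T U : Type) (f : T -> U) (k : nat) (s : seq T) :
  map f (flatten (nseq k s)) = flatten (nseq k (map f s)).
Proof. by rewrite map_flatten map_nseq. Qed.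

Lemma count_flatten_nseq (T : Type) (a : pred T) (k : nat) (s : seq T) :
  count a (flatten (nseq k s)) = (k * count a s)%N.
Proof. by rewrite count_flatten map_nseq sumn_nseq mulnC. Qed.

(** Serves to pair the conjugates of two numbers so that paired ones have the same [n]-th power. *)
Lemma perm_map_lift (T U : eqType) (f : T -> U) (s t : seq T) :
  perm_eq (map f s) (map f t) -> exists2 t', perm_eq t' t & map f t' = map f s.
Proof.
case: t => [|x0 t] eq_st.
  by exists [::] => //; move/perm_size: eq_st; case: s.
have /(perm_iotaP (f x0))[I eqI ->] := eq_st.
exists (map (nth x0 (x0 :: t)) I).
  by apply/(perm_iotaP x0); exists I => //; rewrite -(size_map f).
rewrite -map_comp; apply/eq_in_map => i.
by rewrite (perm_mem eqI) mem_iota size_map => lt_i /=; rewrite -(nth_map _ (f x0)).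
Qed.

Lemma zcontentsX (p : {poly int}) (k : nat) :
  zcontents p = 1 -> zcontents (p ^+ k) = 1.
Proof.
move=> p1; elim: k => [|k IHk]; first exact/zcontents_monic/monic1.
by rewrite exprS zcontentsM p1 IHk.
Qed.

(** Gauss's lemma: if [b%:~R *: P] comes from the integer polynomial [q], then
    [lead_coef p *: q = b *: p], and comparing contents gives the quotient [zcontents q]. *)
Lemma dvdz_lead_coef_primitive (p : {poly int}) (P : {poly algC}) (b : int) :
    zcontents p = 1 -> pZtoC p = (lead_coef p)%:~R *: P ->
  b%:~R *: P \is a polyOver Num.int -> (lead_coef p %| b)%Z.
Proof.
move=> p1 Dp /floorpP[q Dq]; apply/dvdzP; exists (zcontents q).
have Dpq: lead_coef p *: q = b *: p.
  apply: (map_inj_poly (intr_inj (R := algC))) => //=.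
  by rewrite !linearZ /= -Dq Dp !scalerA mulrC.
by have := congr1 zcontents Dpq; rewrite !zcontentsZ p1 mulr1 mulrC.
Qed.

(** Scaled by [lead_coef p], the twisted product has algebraic integer coefficients. They are also
    rational, being those of [q] up to a rational factor, so they are integers and primitivity of
    [q] applies. *)
Lemma dvdz_lead_coef_twist (p q : {poly int}) (r : seq (algC * algC)) :
    {in unzip1 r, forall v, v \in Aint} -> zcontents q = 1 ->
    pZtoC p = (lead_coef p)%:~R *: \prod_(z <- r) ('X - z.2%:P) ->
    pZtoC q = (lead_coef q)%:~R *: \prod_(z <- r) ('X - (z.1 * z.2)%:P) ->
  (lead_coef q %| lead_coef p)%Z.
Proof.
move=> Ar q1 Dp Dq; apply: (dvdz_lead_coef_primitive q1 Dq).
set Q := \prod_(z <- r) _ in Dq *.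
have nz_q : (lead_coef q)%:~R != 0 :> algC.
  rewrite intr_eq0 lead_coef_eq0 -zcontents_eq0 q1 //.
have QE : Q = (lead_coef q)%:~R^-1 *: pZtoC q.
  by rewrite Dq scalerA mulVf ?scale1r.
have AQ : (lead_coef p)%:~R *: Q \is a polyOver Aint.
  rewrite -[_%:~R]mul1r; apply: (polyOver_Aint_prod_XsubC_twist Aint1 Ar).
  rewrite -Dp; apply/polyOverP => i; rewrite coef_map /=; exact: Aint_int.
apply/polyOverP => i; apply: Cint_rat_Aint; last exact: (polyOverP AQ).
by rewrite QE !coefZ coef_map /= !(rpredM, rpredV) // rpred_int.
Qed.

(** Inverses of roots of unity are again algebraic integers, so the twist can be undone and
    divisibility holds both ways. *)
Lemma lead_coef_twist (p q : {poly int}) (r : seq (algC * algC)) (n : nat) :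
    (0 < n)%N -> {in unzip1 r, forall v, v ^+ n = 1} ->
    zcontents p = 1 -> 0 < lead_coef p -> zcontents q = 1 -> 0 < lead_coef q ->
    pZtoC p = (lead_coef p)%:~R *: \prod_(z <- r) ('X - z.2%:P) ->
    pZtoC q = (lead_coef q)%:~R *: \prod_(z <- r) ('X - (z.1 * z.2)%:P) ->
  lead_coef p = lead_coef q.
Proof.
move=> n0 r1 p1 p0 q1 q0 Dp Dq.
have Ar: {in unzip1 r, forall v, v \in Aint}.
  by move=> v /r1 v1; apply: (Aint_unity_root n0); apply/unity_rootP.
have dvd_qp := dvdz_lead_coef_twist Ar q1 Dp Dq.
pose r' := [seq (z.1 ^-1, z.1 * z.2) | z <- r].
have nz_r z : z \in r -> z.1 != 0.
  move=> /(map_f fst)/r1 z1; apply: contra_eq_neq z1 => ->.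
  by rewrite expr0n eqn0Ngt n0 eq_sym oner_eq0.
have dvd_pq : (lead_coef p %| lead_coef q)%Z.
  apply: (@dvdz_lead_coef_twist q p r' _ p1).
  - move=> _ /mapP[_ /mapP[z r_z ->] ->] /=.
    apply: (Aint_unity_root n0); apply/unity_rootP.
    by rewrite exprVn r1 ?invr1 // map_f.
  - by rewrite big_map.
  rewrite big_map Dp; congr (_ *: _); apply: eq_big_seq => z r_z /=.
  by rewrite mulKf ?nz_r.
rewrite -(gtz0_abs p0) -(gtz0_abs q0); congr Posz; apply/eqP.
by rewrite eqn_dvd -!dvdzE dvd_pq.
Qed.

Lemma int_minpoly_exists (x : algC) : exists p, int_minpoly x p.
Proof.
have [q [Dq mon_q] _] := minCpolyP x; have [p [a nz_a Dp]] := rat_poly_scale q.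
have nz_p: p != 0.
  apply: contraTneq mon_q => p0.
  by rewrite Dp p0 map_poly0 scaler0 monicE lead_coef0 eq_sym oner_eq0.
exists (zprimitive p); split; first by rewrite zcontents_primitive nz_p.
have lead_p: 0 < lead_coef (zprimitive p).
  by rewrite -sgz_gt0 sgz_lead_primitive nz_p.
split=> //; have nz_l: (lead_coef (zprimitive p))%:~R != 0 :> algC.
  by rewrite intr_eq0 gt_eqF.
have [b Db]: exists b : algC, minCpoly x = b *: pZtoC (zprimitive p).
  exists (ratr (a%:~R^-1 * (zcontents p)%:~R)).
  rewrite Dq Dp {1}[p]zpolyEprim.
  by apply/polyP=> i; rewrite !(coefZ, coef_map) /= !rmorphM /= !ratr_int mulrA.
have := monicP (minCpoly_monic x); rewrite {1}Db lead_coefZ.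
rewrite lead_coef_map_inj //; last exact: intr_inj.
by move=> b1; rewrite Db scalerA mulrC b1 scale1r.
Qed.

Lemma int_minpoly_uniq (x : algC) (p q : {poly int}) :
  int_minpoly x p -> int_minpoly x q -> p = q.
Proof.
move=> [p1 [p0 Dp]] [q1 [q0 Dq]].
have Dpq: lead_coef q *: p = lead_coef p *: q.
  apply: (map_inj_poly (intr_inj (R := algC))) => //=.
  by rewrite !linearZ /= Dp Dq !scalerA mulrC.
have lead_pq: lead_coef q = lead_coef p.
  by have := congr1 zcontents Dpq; rewrite !zcontentsZ p1 q1 !mulr1.
move: Dpq; rewrite lead_pq -!mul_polyC; apply: mulfI.
by rewrite polyC_eq0 gt_eqF.
Qed.

(** The value picked by [epsilon] is forced: the primitive polynomial is unique, and two
    factorizations of [minCpoly x] list the same roots up to order. *)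
Lemma mahlerE (x : algC) (p : {poly int}) (s : seq algC) :
    int_minpoly x p -> minCpoly x = \prod_(z <- s) ('X - z%:P) ->
  mahler x = (lead_coef p)%:~R * \prod_(z <- s) Num.max 1 `|z|.
Proof.
move=> Dp Ds; have ex_m: exists m, is_mahler x m.
  by exists ((lead_coef p)%:~R * \prod_(z <- s) Num.max 1 `|z|), p, s.
have [q [t [Dq [Dt Dm]]]] := epsilon_spec (inhabits 0) (is_mahler x) ex_m.
rewrite /mahler Dm (int_minpoly_uniq Dp Dq); congr (_ * _); apply: perm_big.
by apply: prod_XsubC_eq; rewrite -Dt -Ds.
Qed.

Lemma mahler_ge1 (x : algC) : 1 <= mahler x.
Proof.
have [p Dp] := int_minpoly_exists x; have [s Ds] := minCpoly_prod_XsubC x.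
rewrite (mahlerE Dp Ds); case: Dp => _ [p0 _]; apply: mulr_ege1.
  by rewrite ler1z -gtz0_ge1.
elim/big_rec: _ => // z m _ m1; apply: mulr_ege1 => //.
by rewrite /Order.max; case: ifP => // /ltW.
Qed.

(** Since [nu] fixes rational coefficients, it permutes [s]; being injective, it also carries
    coincidences among [n]-th powers to coincidences. *)
Lemma count_power_conjugates (x : algC) (s : seq algC) (n : nat)
    (nu : {rmorphism algC -> algC}) :
    minCpoly x = \prod_(z <- s) ('X - z%:P) ->
  count_mem (nu (x ^+ n)) [seq z ^+ n | z <- s] =
  count_mem (x ^+ n) [seq z ^+ n | z <- s].
Proof.
move=> Ds; have nu_s: perm_eq (map nu s) s.
  apply: prod_XsubC_eq; rewrite -Ds; have [q [Dq _] _] := minCpolyP x.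
  have: map_poly nu (minCpoly x) = minCpoly x.
    by rewrite Dq -map_poly_comp; apply: eq_map_poly => a /=; apply: fmorph_rat.
  rewrite {1}Ds rmorph_prod big_map => <-; apply: eq_bigr => z _.
  by rewrite rmorphB /= map_polyX map_polyC.
rewrite -(seq.permP (perm_map _ nu_s)) -map_comp !count_map; apply: eq_count => z /=.
by rewrite -rmorphXn (inj_eq (fmorph_inj nu)).
Qed.

(* Automorphisms act transitively on the conjugates of [x ^+ n = y ^+ n], so all
   of them are the [n]-th power of equally many conjugates of [x], and likewise
   for [y]. *)
Lemma perm_power_conjugates (x y : algC) (s t : seq algC) (n : nat) :
    x ^+ n = y ^+ n ->
    minCpoly x = \prod_(z <- s) ('X - z%:P) ->
    minCpoly y = \prod_(z <- t) ('X - z%:P) ->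
  exists k l : nat, [/\ (0 < k)%N, (0 < l)%N &
    perm_eq [seq z ^+ n | z <- flatten (nseq k s)]
            [seq z ^+ n | z <- flatten (nseq l t)]].
Proof.
move=> xy Ds Dt; pose f z : algC := z ^+ n.
have count_gt0 u r : minCpoly u = \prod_(z <- r) ('X - z%:P) ->
    (0 < count_mem (f u) (map f r))%N.
  move=> Dr; rewrite -has_count has_pred1 map_f //.
  by rewrite -root_prod_XsubC -Dr root_minCpoly.
have orbit u r w : minCpoly u = \prod_(z <- r) ('X - z%:P) -> w \in map f r ->
    exists nu : {rmorphism algC -> algC}, w = nu (f u).
  move=> Dr /mapP[v r_v ->].
  have [|nu Dnu] := @minCpoly_transitive u v; first by rewrite Dr root_prod_XsubC.
  by exists nu; rewrite rmorphXn Dnu.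
(* The multiplicities are exchanged, so that each common power occurs on both sides as often as
   their product. *)
exists (count_mem (f y) (map f t)), (count_mem (f x) (map f s)).
split; rewrite ?count_gt0 //; apply/allP => w; rewrite -!/(map f _) mem_cat => w_st.
rewrite !map_flatten_nseq /= !count_flatten_nseq.
suffices [nu ->]: exists nu : {rmorphism algC -> algC}, w = nu (f x).
  rewrite !(count_power_conjugates _ _ Ds) /f xy (count_power_conjugates _ _ Dt).
  by rewrite mulnC.
case/orP: w_st => /mapP[v /flattenP[r /nseqP[-> _] r_v] ->].
  exact: orbit Ds (map_f f r_v).
by rewrite /f xy; apply: orbit Dt (map_f f r_v).
Qed.

Lemma mem_zip_map (T U : eqType) (f : T -> U) (s t : seq T) (w : T * T) :
  map f t = map f s -> w \in zip s t -> w.1 \in s /\ f w.2 = f w.1.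
Proof.
elim: s t => [|a s IHs] [|b t] //= [Eab Est].
case/predU1P=> [-> | /(IHs _ Est)[s_w ->]]; first by rewrite /= mem_head.
by rewrite inE s_w orbT.
Qed.

Lemma zcontents_lead_mapX (p : {poly int}) (P : {poly algC}) (k : nat) :
    zcontents p = 1 -> 0 < lead_coef p -> pZtoC p = (lead_coef p)%:~R *: P ->
  [/\ zcontents (p ^+ k) = 1, 0 < lead_coef (p ^+ k)
    & pZtoC (p ^+ k) = (lead_coef (p ^+ k))%:~R *: P ^+ k].
Proof.
move=> p1 p0 Dp; split; rewrite ?lead_coef_exp ?zcontentsX ?exprn_gt0 //.
by rewrite rmorphXn /= Dp exprZn rmorphXn.
Qed.

(** After [k] copies of the conjugates of [x] are matched with [l] copies of those of [y], paired
    roots have equal absolute value and [p ^+ k], [q ^+ l] have equal leading coefficients. This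
    gives [mahler x ^+ k = mahler y ^+ l], while counting roots gives
    [k * algdeg x = l * algdeg y]. *)
Lemma mahler_mul_root_of_unity (x z : algC) :
    x != 0 -> Defs.root_of_unity z ->
  mahler (z * x) ^+ algdeg x = mahler x ^+ algdeg (z * x).
Proof.
move=> nz_x [n n0 z1]; set y := z * x.
have [p Dp] := int_minpoly_exists x; have [q Dq] := int_minpoly_exists y.
have [s Ds] := minCpoly_prod_XsubC x; have [t Dt] := minCpoly_prod_XsubC y.
have xyn: x ^+ n = y ^+ n by rewrite exprMn z1 mul1r.
have [k [l [k0 l0 eq_st]]] := perm_power_conjugates xyn Ds Dt.
have [t' eq_t' Dt'] := perm_map_lift eq_st.
set s' := flatten (nseq k s) in Dt' eq_st *.
have sz_t': size t' = size s' by have := congr1 size Dt'; rewrite !size_map.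
have zip_st w : w \in zip s' t' -> w.1 != 0 /\ w.2 ^+ n = w.1 ^+ n.
  case/(mem_zip_map Dt') => /flattenP[_ /nseqP[-> _] s_w] ->; split=> //.
  have [|nu <-] := @minCpoly_transitive x w.1; first by rewrite Ds root_prod_XsubC.
  by rewrite fmorph_eq0.
(* Each quotient is an [n]-th root of unity, because paired conjugates have the same [n]-th
   power. *)
pose r := [seq (w.2 / w.1, w.1) | w <- zip s' t'].
have prod_s' (R : comNzRingType) (F : algC -> R) :
    \prod_(w <- zip s' t') F w.1 = (\prod_(v <- s) F v) ^+ k.
  by rewrite -prod_flatten_nseq -/s' -{2}[s'](@unzip1_zip _ _ s' t') ?sz_t' ?big_map.
have prod_t' (R : comNzRingType) (F : algC -> R) :
    \prod_(w <- zip s' t') F w.2 = (\prod_(v <- t) F v) ^+ l.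
  rewrite -prod_flatten_nseq -(perm_big _ eq_t') /=.
  by rewrite -{2}[t'](@unzip2_zip _ _ s' t') ?sz_t' ?big_map.
have [p1 [p0 Dpx]] := Dp; have [q1 [q0 Dqy]] := Dq.
have [pk1 pk0 Dpk] := zcontents_lead_mapX k p1 p0 Dpx.
have [ql1 ql0 Dql] := zcontents_lead_mapX l q1 q0 Dqy.
have lead_pq: lead_coef (p ^+ k) = lead_coef (q ^+ l).
  apply: (@lead_coef_twist _ _ r n n0) => //.
  - move=> _ /mapP[_ /mapP[w st_w ->] ->] /=; have [w0 Dw] := zip_st w st_w.
    by rewrite expr_div_n Dw divff ?expf_neq0.
  - by rewrite Dpk Ds big_map /= (prod_s' _ (fun v => 'X - v%:P)).
  rewrite Dql Dt big_map; congr (_ *: _).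
  rewrite -(prod_t' _ (fun v => 'X - v%:P)).
  by apply: eq_big_seq => w /zip_st[w0 _] /=; rewrite divfK.
have Mkl: mahler x ^+ k = mahler y ^+ l.
  rewrite (mahlerE Dp Ds) (mahlerE Dq Dt) !exprMn.
  rewrite -(prod_s' _ (fun v => Num.max 1 `|v|)).
  rewrite -(prod_t' _ (fun v => Num.max 1 `|v|)).
  rewrite -!rmorphXn -!lead_coef_exp lead_pq; congr (_ * _).
  apply: eq_big_seq => w /zip_st[_ Dw]; congr Num.max.
  by apply/eqP; rewrite -(@eqrXn2 _ n) // -!normrX Dw.
have degE u (v : seq algC) : minCpoly u = \prod_(c <- v) ('X - c%:P) ->
  algdeg u = size v by rewrite /algdeg => ->; rewrite size_prod_XsubC.
have kl: (k * algdeg x = l * algdeg y)%N.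
  rewrite (degE x s) // (degE y t) // -!count_predT -!count_flatten_nseq.
  by rewrite !count_predT -/s' -sz_t' (perm_size eq_t').
have M0 u : 0 <= mahler u by apply: le_trans (mahler_ge1 u).
(* Both sides are nonnegative, so they may be compared after raising to the power [l], where the two
   relations combine. *)
apply/eqP; rewrite -(@eqrXn2 _ l) ?exprn_ge0 // -!exprM mulnC exprM -Mkl.
by rewrite -!exprM kl mulnC.
Qed.

(** * The modified Mahler measure *)

Lemma root_of_unity1 : Defs.root_of_unity 1.
Proof. by exists 1%N; rewrite ?expr1. Qed.

Lemma root_of_unityM (u v : algC) :
  Defs.root_of_unity u -> Defs.root_of_unity v -> Defs.root_of_unity (u * v).
Proof.
move=> [m m0 um] [n n0 vn]; exists (m * n)%N; first by rewrite muln_gt0 m0.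
by rewrite exprMn exprM um mulnC exprM vn !expr1n mulr1.
Qed.

Lemma root_of_unityV (u : algC) :
  Defs.root_of_unity u -> Defs.root_of_unity u^-1.
Proof. by move=> [n n0 un]; exists n; rewrite ?exprVn ?un ?invr1. Qed.

Lemma root_of_unity_neq0 (u : algC) : Defs.root_of_unity u -> u != 0.
Proof.
move=> [n n0 un]; apply: contra_eq_neq un => ->.
by rewrite expr0n eqn0Ngt n0 eq_sym oner_eq0.
Qed.

Lemma root_of_unity_norm (u : algC) : Defs.root_of_unity u -> `|u| = 1.
Proof.
move=> [n n0 un]; apply/eqP; rewrite -(@eqrXn2 _ n) //.
by rewrite -normrX un normr1 expr1n.
Qed.

Lemma algdeg_gt0 (x : algC) : (0 < algdeg x)%N.
Proof. by rewrite /algdeg -ltnS prednK ?size_minCpoly // ltnW ?size_minCpoly. Qed.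

Lemma mbar_attained (x u : algC) :
    Defs.root_of_unity u ->
    (forall z, Defs.root_of_unity z -> mahler (u * x) <= mahler (z * x)) ->
  mbar x = mahler (u * x).
Proof.
move=> u1 min_u; have mbar_u: is_mbar x (mahler (u * x)).
  by split=> // y _; apply.
have [lb_m max_m] := epsilon_spec (inhabits 0) (is_mbar x) (ex_intro _ _ mbar_u).
have M_real z : mahler z \is Num.real.
  exact/ger0_real/(le_trans ler01)/mahler_ge1.
apply/le_anti; rewrite /mbar lb_m //= max_m //.
Qed.

(** Raised to the power [algdeg (u * x)], the measure of [z * x] becomes
    [mahler (u * x) ^+ algdeg (z * x)]. As the base is at least 1, the least degree gives the least
    measure. *)
Lemma mbar_min_algdeg (x u : algC) :
    x != 0 -> Defs.root_of_unity u ->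
    (forall z, Defs.root_of_unity z -> (algdeg (u * x)%R <= algdeg (z * x)%R)%N) ->
  mbar x = mahler (u * x).
Proof.
move=> nz_x u1 min_u; apply: mbar_attained => // z z1.
have M0 y : 0 <= mahler y by apply: le_trans (mahler_ge1 y).
have Dzx: z * x = z / u * (u * x) by rewrite mulrA divfK ?root_of_unity_neq0.
rewrite -(@ler_pXn2r _ (algdeg (u * x)%R)) ?algdeg_gt0 ?qualifE //=.
rewrite [in leRHS]Dzx mahler_mul_root_of_unity -?Dzx.
- by apply: ler_weXn2l; [exact: mahler_ge1 | exact: min_u].
- by rewrite mulf_neq0 // root_of_unity_neq0.
by apply: root_of_unityM => //; apply: root_of_unityV.
Qed.

(** * Degree at most two and rational multiples of roots of unity *)

Lemma algdeg_leq (x : algC) (p : {poly algC}) :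
  p \is a polyOver Crat -> p != 0 -> root p x -> (algdeg x < size p)%N.
Proof.
move=> /polyOverP rat_p nz_p px0; rewrite /algdeg prednK ?(ltnW (size_minCpoly x)) //.
apply: dvdp_leq => //; have [q [-> _] min_q] := minCpolyP x.
have Dp: p = map_poly ratr (map_poly getCrat p).
  rewrite -map_poly_comp -[LHS]coefK; apply/polyP => i.
  by rewrite coef_map_id0 ?coefK /= ?CratrE //= ?getCratK // raddf0.
by rewrite Dp dvdp_map -min_q -Dp.
Qed.

Lemma Crat_algdeg1 (x : algC) : x \in Crat <-> algdeg x = 1.
Proof.
split=> [Qx | deg_x].
  apply/eqP; rewrite eqn_leq algdeg_gt0 andbT.
  have := @algdeg_leq x ('X - x%:P); rewrite size_XsubC; apply;
    rewrite ?polyOverXsubC ?polyXsubC_eq0 ?root_XsubC //.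
have [s Ds] := minCpoly_prod_XsubC x.
move: deg_x; rewrite /algdeg Ds size_prod_XsubC /=; case: s Ds => [|y [|//]] //.
rewrite big_seq1 => Ds _; have := root_minCpoly x; rewrite Ds root_XsubC => /eqP->.
have [p [Dp _] _] := minCpolyP x; have := congr1 (fun p : {poly _} => p`_0) Ds.
rewrite Dp coef_map coefB coefX coefC sub0r /= => Dy.
by rewrite -[y]opprK -Dy rpredN Crat_rat.
Qed.

Lemma mbar_Crat (x u : algC) :
  x != 0 -> Defs.root_of_unity u -> u * x \in Crat -> mbar x = mahler (u * x).
Proof.
move=> nz_x u1 /Crat_algdeg1 deg1; apply: mbar_min_algdeg => // z _.
by rewrite deg1 algdeg_gt0.
Qed.

(** Either no multiple of [x] by a root of unity has smaller degree, or some multiple has degree 1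
    and is rational. In the second case [v] is irrational, since otherwise [x] would already have
    degree 1. *)
Lemma mbar_eq_or_rational_multiple (x : algC) :
    x != 0 -> (algdeg x <= 2)%N ->
  mbar x = mahler x \/
  exists r v, [/\ r \in Crat, Defs.root_of_unity v, v \notin Crat & x = r * v].
Proof.
move=> nz_x deg_x.
have [[z [z1 lt_z]]|no_z] :=
  classic (exists z, Defs.root_of_unity z /\ (algdeg (z * x)%R < algdeg x)%N).
  have Qzx : z * x \in Crat.
    apply/Crat_algdeg1/eqP; rewrite eqn_leq algdeg_gt0 andbT -ltnS.
    exact: leq_trans lt_z deg_x.
  right; exists (z * x), z^-1; split=> //; first exact: root_of_unityV.
    apply: contraL lt_z => Qz; suff /Crat_algdeg1-> : x \in Crat.
      by rewrite ltnNge algdeg_gt0.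
    by rewrite -(mulKf (root_of_unity_neq0 z1) x) rpredM.
  by rewrite mulrC mulKf ?root_of_unity_neq0.
left; rewrite -[x in RHS]mul1r; apply: mbar_min_algdeg => // [|z z1].
  exact: root_of_unity1.
by rewrite mul1r leqNgt; apply/negP => lt_z; apply: no_z; exists z.
Qed.

(** The witness is [t = v + v^-1]. As [v^-1] is the complex conjugate of [v], the trace of [r * v]
    is [r * t], so [t] is rational; it is also an algebraic integer of absolute value at most 2. *)
Lemma quadratic_root_of_unity (r v : algC) :
    r \in Crat -> Defs.root_of_unity v -> v \notin Crat ->
    (algdeg (r * v)%R <= 2)%N -> r != 0 ->
  exists2 t, t \in [:: 0; 1; -1] & v ^+ 2 = t * v - 1.
Proof.
move=> Qr v1 QNv deg_x nz_r; set x := r * v in deg_x.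
have nz_v := root_of_unity_neq0 v1.
have vVc: v^* = v^-1.
  by apply: (mulfI nz_v); rewrite -normCK root_of_unity_norm // expr1n divff.
have v2_neq1: v ^+ 2 != 1.
  apply: contra QNv; rewrite sqrf_eq1 => /orP[] /eqP->; rewrite ?rpredN rpred1 //.
have Dxc: x^* = r * v^-1 by rewrite rmorphM /= vVc (CrealP (Creal_Crat Qr)).
have x_neq: x^* != x.
  rewrite Dxc /x; apply: contra v2_neq1 => /eqP/(mulfI nz_r) vV.
  by rewrite expr2 -{1}vV mulVf.
have QNx: x \notin Crat.
  by apply: contra QNv => Qx; rewrite -(mulKf nz_r v) rpredM ?rpredV.
have sz_min: size (minCpoly x) = 3.
  rewrite -(prednK (ltnW (size_minCpoly x))) -/(algdeg x); congr _.+1; apply/eqP.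
  rewrite eqn_leq deg_x ltn_neqAle algdeg_gt0 andbT eq_sym.
  by apply: contra QNx => /eqP/Crat_algdeg1.
(* Complex conjugation supplies a second root, distinct from [x], and degree two leaves no other. *)
have Dmin: minCpoly x = ('X - x%:P) * ('X - x^*%:P).
  rewrite (@all_roots_prod_XsubC _ _ [:: x; x^*] sz_min).
  - by rewrite (monicP (minCpoly_monic x)) scale1r big_cons big_seq1.
  - by rewrite /= root_minCpoly -(minCpoly_aut Num.conj x) root_minCpoly.
  by rewrite uniq_rootsE /= inE eq_sym x_neq.
have Qt: v + v^-1 \in Crat.
  have [q [Dq _] _] := minCpolyP x.
  have Qx: x + x^* \in Crat.
    have := congr1 (fun p : {poly _} => - p`_1) Dmin; rewrite Dq coef_map /=.
    have XsubC2 (a b : algC) :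
        ('X - a%:P) * ('X - b%:P) = 'X^2 - (a + b)%:P * 'X + (a * b)%:P.
      by rewrite polyCD polyCM; ring.
    rewrite XsubC2.
    rewrite !(coefD, coefN, coefCM, coefX, coefXn, coefC) /=.
    by rewrite mulr1 add0r addr0 opprK => <-; rewrite rpredN Crat_rat.
  rewrite -(mulKf nz_r (v + v^-1)) mulrDr -Dxc -/x.
  by rewrite rpredM ?rpredV.
have At: v + v^-1 \in Num.int.
  have Aint_v w : Defs.root_of_unity w -> w \in Aint.
    by case=> n n0 wn; apply: (Aint_unity_root n0); apply/unity_rootP.
  by apply: Cint_rat_Aint Qt _; rewrite rpredD ?Aint_v //; apply: root_of_unityV.
have [m Dm] := intrP At.
have Dv2: v ^+ 2 = (v + v^-1) * v - 1 by rewrite mulrDl mulVf // -expr2 addrK.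
have m_le2: (`|m| <= 2).
  rewrite -(ler_int algC) intr_norm -Dm (le_trans (ler_normD _ _)) //.
  by rewrite normfV root_of_unity_norm // invr1.
(* Excludes the extreme values 2 and -2: they would make [v] a double root, equal to 1 or -1. *)
have m_neq (e : algC) : e ^+ 2 = 1 -> v + v^-1 <> 2 * e.
  move=> e1 Dt; have /eqP : (v - e) ^+ 2 = 0.
    by rewrite sqrrB e1 Dv2 Dt; ring.
  rewrite expf_eq0 subr_eq0 /= => /eqP ve.
  by rewrite ve e1 eqxx in v2_neq1.
exists (v + v^-1) => //; rewrite Dm !inE.
have {m_le2}: m \in [:: -2; -1; 0; 1; 2] by rewrite !inE; lia.
rewrite !inE => /or4P[/eqP m2|/eqP->|/eqP->|/orP[/eqP->|/eqP m2]]; rewrite ?eqxx ?orbT //.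
  by case: (m_neq (-1)); [rewrite sqrrN expr1n | rewrite Dm m2; ring].
by case: (m_neq 1); [rewrite expr1n | rewrite Dm m2; ring].
Qed.

(** * The fields generated by ['i] and [sqrtC (-3)] *)

Lemma in_Qgen_affine (x y a b : algC) :
    a \in Crat -> b \in Crat -> x = a + b * y ->
  forall w, in_Qgen x w -> in_Qgen y w.
Proof.
move=> Qa Qb Dx w [p [q [Qp Qq nz_q ->]]]; pose h := a%:P + b%:P * 'X.
have Qh: h \is a polyOver Crat.
  by rewrite /h rpredD ?rpredM ?polyOverC ?polyOverX.
have hy: h.[y] = x by rewrite /h hornerD hornerCM hornerC hornerX -Dx.
exists (p \Po h), (q \Po h).
by rewrite !horner_comp hy; split=> //; apply: polyOver_comp.
Qed.

Lemma same_Qfield_affine (x y a b : algC) :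
    a \in Crat -> b \in Crat -> b != 0 -> x = a + b * y -> same_Qfield x y.
Proof.
move=> Qa Qb nz_b Dx w; split; first exact: in_Qgen_affine Qa Qb Dx w.
apply: (@in_Qgen_affine _ _ (- a / b) b^-1); rewrite ?(rpredM, rpredN, rpredV) //.
by rewrite Dx; field.
Qed.

(** A rational root of a monic integer polynomial is an integer, and no integer square lies strictly
    between 1 and 4. *)
Lemma Crat_sqr_neq3 (x : algC) : x \in Crat -> x ^+ 2 != 3.
Proof.
move=> Qx; apply/eqP => x2.
have /intrP[m Dm]: x \in Num.int.
  apply: Cint_rat_Aint Qx _; apply: (@root_monic_Aint ('X^2 - 3%:P)).
  - by rewrite /root !hornerE x2 subrr.
  - by rewrite monicXnsubC.
  apply/polyOverP => i; rewrite coefB coefXn coefC.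
  by rewrite rpredB ?rpred_nat //; case: ifP => _; rewrite ?rpred0 ?rpred_nat.
have /eqP : (m ^+ 2)%:~R = 3%:~R :> algC by rewrite rmorphXn /= -Dm x2.
rewrite eqr_int expr2 => /eqP m3.
have [m2|m2] : 2 <= m \/ m <= 1 by lia.
  by nia.
have [m2'|m2'] : m <= -2 \/ -1 <= m by lia.
  by nia.
have : m \in [:: -1; 0; 1] by rewrite !inE; lia.
by rewrite !inE => /or3P[] /eqP mE; rewrite mE in m3.
Qed.

Lemma sqr_lt0_notin_Crat (y : algC) : y ^+ 2 < 0 -> y \notin Crat.
Proof.
move=> y2; apply: contraL y2 => /Creal_Crat y_real.
by rewrite -real_leNgt ?real_exprn_even_ge0 // rpredX.
Qed.

(* For irrational [y] with [y ^+ 2 = - D], comparing coordinates on [1, y] in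
   [x ^+ 2 = t * r * x - r ^+ 2] gives the trace [2a] and the norm [a^2 + D b^2]. *)
Lemma rational_multiple_trace_norm (D y a b r v t : algC) :
    y ^+ 2 = - D -> y \notin Crat ->
    [/\ D \in Crat, a \in Crat, b \in Crat, r \in Crat & t \in Crat] ->
    b != 0 -> v ^+ 2 = t * v - 1 -> a + b * y = r * v ->
  2 * a = r * t /\ r ^+ 2 = a ^+ 2 + D * b ^+ 2.
Proof.
move=> y2 QNy [QD Qa Qb Qr Qt] nz_b v2 Dx.
have Ex : (a + b * y) ^+ 2 = r * t * (a + b * y) - r ^+ 2.
  by rewrite {1}Dx exprMn v2 Dx; ring.
have E0 : a ^+ 2 - D * b ^+ 2 - r * t * a + r ^+ 2 = (r * t - 2 * a) * b * y.
  have -> : r ^+ 2 = r * t * (a + b * y) - (a + b * y) ^+ 2 by rewrite Ex; ring.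
  have -> : D = - y ^+ 2 by rewrite y2 opprK.
  by ring.
have rt: r * t = 2 * a.
  (* A nonzero coefficient of [y] in [E0] would allow solving for [y] in rational terms. *)
  apply/eqP; rewrite -subr_eq0; apply: contraNT QNy => nz.
  have -> : y = (a ^+ 2 - D * b ^+ 2 - r * t * a + r ^+ 2) / ((r * t - 2 * a) * b).
    by rewrite E0 mulrC mulKf // mulf_neq0.
  by rewrite !(rpredM, rpredV, rpredB, rpredD, rpredX, rpred_nat).
split=> //; move/eqP: E0; rewrite rt subrr !mul0r => /eqP E0.
rewrite -[LHS](subKr 0).
have -> : r ^+ 2 = 0 - (a ^+ 2 - D * b ^+ 2 - 2 * a * a) by rewrite -E0; ring.
by ring.
Qed.

(** Otherwise [a + b * y = r * v]. If [t = 0], then [a = 0], which is excluded for [D = 1] and makes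
    [r / b] a square root of 3 for [D = 3]. If [t] is 1 or -1, then [D * b ^+ 2 = 3 * a ^+ 2]: for
    [D = 1] the ratio [b / a] is a square root of 3, and for [D = 3] the excluded case [a = b] or
    [a = - b] returns. *)
Lemma mbar_imaginary_quadratic (D y a b : algC) :
    D = 1 \/ D = 3 -> y ^+ 2 = - D -> a \in Crat -> b \in Crat ->
    a + b * y != 0 -> (algdeg (a + b * y)%R <= 2)%N ->
    ~~ ((D == 1) && (a == 0)) -> ~~ ((D == 3) && ((a == b) || (a == - b))) ->
  mbar (a + b * y) = mahler (a + b * y).
Proof.
move=> D13 y2 Qa Qb nz_x deg_x not1 not3.
have QD: D \in Crat by case: D13 => ->; rewrite ?rpred1 ?rpred_nat.
have D_gt0: 0 < D by case: D13 => ->; rewrite ?ltr01 ?ltr0n.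
have QNy: y \notin Crat by rewrite sqr_lt0_notin_Crat // y2 oppr_lt0.
have [//|[r [v [Qr v1 QNv Dx]]]] := mbar_eq_or_rational_multiple nz_x deg_x.
have nz_r: r != 0 by apply: contraNneq nz_x => r0; rewrite Dx r0 mul0r.
have nz_b: b != 0.
  apply: contraNneq QNv => b0; rewrite -(mulKf nz_r v) -Dx b0 mul0r addr0.
  by rewrite rpredM ?rpredV.
have [|t t3 v2] := quadratic_root_of_unity Qr v1 QNv _ nz_r; first by rewrite -Dx.
have Qt: t \in Crat.
  by move: t3; rewrite !inE => /or3P[] /eqP->; rewrite ?rpredN ?rpred0 ?rpred1.
have [|tr nm] := rational_multiple_trace_norm y2 QNy _ nz_b v2 Dx; first by [].
have b3 c : c \in Crat -> c ^+ 2 = 3 * b ^+ 2 -> False.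
  move=> Qc c3; have /Crat_sqr_neq3: c / b \in Crat by rewrite rpredM ?rpredV.
  by rewrite expr_div_n c3 mulfK ?expf_neq0 ?eqxx.
have nz_2 : 2 != 0 :> algC by rewrite pnatr_eq0.
exfalso; have [t0|nz_t] := eqVneq t 0.
  have a0: a = 0 by apply: (mulfI nz_2); rewrite tr t0 !mulr0.
  case: D13 => DE; first by rewrite DE a0 !eqxx in not1.
  by apply: (b3 r Qr); rewrite nm a0 DE expr0n add0r.
have r2: r ^+ 2 = 4 * a ^+ 2.
  have t2: t ^+ 2 = 1.
    by move: t3 nz_t; rewrite !inE => /or3P[] /eqP->; rewrite ?eqxx ?sqrrN ?expr1n.
  have -> : 4 * a ^+ 2 = (2 * a) ^+ 2 by ring.
  by rewrite tr exprMn t2 mulr1.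
have Db: D * b ^+ 2 = 3 * a ^+ 2.
  have -> : D * b ^+ 2 = r ^+ 2 - a ^+ 2 by rewrite nm; ring.
  by rewrite r2; ring.
case: D13 => DE; rewrite DE in Db not3.
  move: Db; rewrite mul1r => Db.
  have nz_a: a != 0.
    by apply: contraNneq nz_b => a0; rewrite -sqrf_eq0 Db a0 expr0n mulr0.
  have /Crat_sqr_neq3: b / a \in Crat by rewrite rpredM ?rpredV.
  by rewrite expr_div_n Db mulfK ?expf_neq0 ?eqxx.
rewrite eqxx /= -eqf_sqr in not3; case/eqP: not3.
by apply: (@mulfI _ 3); rewrite ?pnatr_eq0.
Qed.

Lemma rational_multiple_same_Qfield (r v : algC) :
    r \in Crat -> Defs.root_of_unity v -> v \notin Crat -> r != 0 ->
    (algdeg (r * v)%R <= 2)%N ->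
  same_Qfield (r * v) 'i \/ same_Qfield (r * v) (sqrtC (-3)).
Proof.
move=> Qr v1 QNv nz_r deg_x; set s := sqrtC (-3).
have s2: s ^+ 2 = -3 by rewrite sqrtCK.
have [t t3 v2] := quadratic_root_of_unity Qr v1 QNv deg_x nz_r.
have Qt: t \in Crat.
  by move: t3; rewrite !inE => /or3P[] /eqP->; rewrite ?rpredN ?rpred0 ?rpred1.
have nz_2 : 2 != 0 :> algC by rewrite pnatr_eq0.
have [t0|nz_t] := eqVneq t 0.
  have: v ^+ 2 == 'i ^+ 2 by rewrite v2 t0 mul0r sub0r sqrCi.
  rewrite eqf_sqr => /orP[/eqP->|/eqP->]; left.
    by apply: (@same_Qfield_affine _ _ 0 r); rewrite ?rpred0 ?add0r.
  apply: (@same_Qfield_affine _ _ 0 (- r)); rewrite ?rpred0 ?rpredN ?oppr_eq0 //.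
  by rewrite add0r mulrN mulNr.
have t2: t ^+ 2 = 1.
  by move: t3 nz_t; rewrite !inE => /or3P[] /eqP->; rewrite ?eqxx ?sqrrN ?expr1n.
(* Completing the square in [v ^+ 2 = t * v - 1] gives the discriminant [t ^+ 2 - 4 = -3]. *)
have: (2 * v - t) ^+ 2 == s ^+ 2.
  have -> : (2 * v - t) ^+ 2 = 4 * (v ^+ 2 - t * v) + t ^+ 2 by ring.
  by rewrite s2 v2 t2; apply/eqP; ring.
rewrite eqf_sqr !subr_eq => Dv; right.
have Qrt: r * t / 2 \in Crat by rewrite !(rpredM, rpredV, rpred_nat).
have Qr2: r / 2 \in Crat by rewrite !(rpredM, rpredV, rpred_nat).
have nz_r2: r / 2 != 0 by rewrite mulf_neq0 ?invr_eq0.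
have -> : r * v = r / 2 * (2 * v) by field.
case/orP: Dv => /eqP->.
  by apply: (same_Qfield_affine Qrt Qr2) => //; ring.
apply: (@same_Qfield_affine _ _ (r * t / 2) (- (r / 2))); rewrite ?rpredN ?oppr_eq0 //.
by ring.
Qed.

Lemma mbar_sixth_root (s a b : algC) :
    s ^+ 2 = -3 -> a \in Crat -> a + b * s != 0 -> (a == b) || (a == - b) ->
  mbar (a + b * s) = mahler (2 * a).
Proof.
move=> s2 Qa nz_x ab; have nz_2 : 2 != 0 :> algC by rewrite pnatr_eq0.
have [e [e2 Db]]: exists e : algC, e ^+ 2 = 1 /\ b = e * a.
  case/orP: ab => /eqP->; first by exists 1; rewrite expr1n mul1r.
  by exists (-1); rewrite sqrrN expr1n mulN1r opprK.
(* A primitive sixth root of unity, with the sign chosen so that [1 - e * s] is conjugate to the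
   factor [1 + e * s] of [a + b * s]; their product is 4. *)
pose v := (1 - e * s) / 2; have v2: v ^+ 2 = v - 1.
  apply: (mulfI (mulf_neq0 nz_2 nz_2)); rewrite /v.
  transitivity (1 - 2 * e * s + e ^+ 2 * s ^+ 2); first by field.
  by rewrite e2 s2; field.
have Dvx: v * (a + b * s) = 2 * a.
  rewrite /v Db; transitivity (a * (1 - e ^+ 2 * s ^+ 2) / 2); first by field.
  by rewrite e2 s2; field.
rewrite -Dvx; apply: mbar_Crat => //; last by rewrite Dvx rpredM ?rpred_nat.
exists 6 => //; have v3: v ^+ 3 = -1 by rewrite exprS v2 mulrBr -expr2 v2; ring.
by rewrite (exprM v 3 2) v3 sqrrN expr1n.
Qed.

Theorem mainTheorem4 (g : algC) (g_neq0 : g != 0) (g_deg : (algdeg g <= 2)%N) :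
  [/\ (~ same_Qfield g 'i -> ~ same_Qfield g (sqrtC (-3)) ->
         mbar g = mahler g),
      (forall a b : algC, a \in Crat -> b \in Crat -> g = a + b * 'i ->
         (a = 0 -> mbar g = mahler b) /\ (a != 0 -> mbar g = mahler g))
    & (forall a b : algC, a \in Crat -> b \in Crat ->
         g = a + b * sqrtC (-3) ->
         ((a == b) || (a == - b) -> mbar g = mahler (2 * a)) /\
         (~~ ((a == b) || (a == - b)) -> mbar g = mahler g))].
Proof.
have neq13: (1 == 3 :> algC) = false by rewrite eq_sym pnatr_eq1.
have neq31: (3 == 1 :> algC) = false by rewrite pnatr_eq1.
split=> [not_i not_s | a b Qa Qb Dg | a b Qa Qb Dg].
- have [//|[r [v [Qr v1 QNv Dg]]]] := mbar_eq_or_rational_multiple g_neq0 g_deg.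
  have nz_r: r != 0 by apply: contraNneq g_neq0 => r0; rewrite Dg r0 mul0r.
  rewrite Dg in g_deg not_i not_s.
  by case: (rational_multiple_same_Qfield Qr v1 QNv nz_r g_deg).
- split=> [a0 | nz_a].
    (* Multiplying by the fourth root of unity [- 'i] makes [g] rational, hence of least degree. *)
    have Db: - 'i * g = b by rewrite Dg a0 add0r mulrCA mulNr -expr2 sqrCi opprK mulr1.
    rewrite -Db; apply: mbar_Crat; rewrite ?Db //.
    by exists 4 => //; rewrite (exprM _ 2 2) sqrrN sqrCi sqrrN expr1n.
  rewrite Dg in g_neq0 g_deg *; apply: mbar_imaginary_quadratic (sqrCi _) _ _ _ _ _ _ => //.
  - by left.
  - by rewrite (negPf nz_a) andbF.
  by rewrite neq13.
have s2: sqrtC (-3) ^+ 2 = -3 :> algC by rewrite sqrtCK.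
rewrite Dg in g_neq0 g_deg *; split=> ab; first exact: mbar_sixth_root.
apply: mbar_imaginary_quadratic s2 _ _ _ _ _ _ => //; first by right.
  by rewrite neq31.
by rewrite eqxx.
Qed.
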